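(* Let $(T,f)$ be a countable tree of height $\le\omega$ with predecessor function $f$. Then $(T,f)$ is ultrahomogeneous if and only if, for every $n$ and any $a,b\in T$ of the same height $n$, $a$ and $b$ have an equal number of (immediate) successors.
   Context: A tree $(T,f)$ in the predecessor formulation is a set $T$ with a root $\epsilon\in T$ and a unary function $f:T\to T$ such that $f(\epsilon)=\epsilon$ and every $a\in T$ satisfies $f^n(a)=\epsilon$ for some $n\in\omega$, $\epsilon$ being the only element $a$ with $f^m(a)=a$ for some $m\geq 1$. The least $n$ with $f^n(a)=\epsilon$ is the height of $a$. The (immediate) successors of $a$ are the elements $b\neq\epsilon$ with $f(b)=a$; their number is a cardinal in $\{0,1,2,\dots,\aleph_0\}$. The structure $(T,f)$ has language consisting of the single unary function symbol $f$. It is ultrahomogeneous if every isomorphism between finitely generated substructures (finite subsets closed under $f$) extends to an automorphism of $(T,f)$. *)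

(* Defs.v *)
From mathcomp Require Import all_boot.
From mathcomp Require Import boolp classical_sets functions cardinality.

Set Implicit Arguments.
Unset Strict Implicit.
Unset Printing Implicit Defensive.

Local Open Scope classical_set_scope.

(* Every element reaches the root in finitely many steps, so "height <= omega"
   is already part of this definition. *)
Record is_tree (T : Type) (eps : T) (f : T -> T) : Prop := IsTree {
  tree_root : f eps = eps;
  tree_reach : forall a : T, exists n : nat, iter n f a = eps;
  tree_acyclic : forall (a : T) (m : nat), (1 <= m)%N -> iter m f a = a -> a = eps
}.

Definition has_height (T : Type) (eps : T) (f : T -> T) (a : T) (n : nat) : Prop :=
  iter n f a = eps /\ forall m : nat, iter m f a = eps -> (n <= m)%N.

Definition successors (T : Type) (eps : T) (f : T -> T) (a : T) : set T :=
  [set b | b <> eps /\ f b = a].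

Definition substructure (T : Type) (f : T -> T) (A : set T) : Prop :=
  forall x : T, A x -> A (f x).

Definition finitely_generated (T : Type) (f : T -> T) (A : set T) : Prop :=
  exists2 S : set T, finite_set S & A = smallest (substructure f) S.

(* An isomorphism between A and B is given by a total function on T of which
   only the restriction to A matters. *)
Definition isomorphism (T : Type) (f : T -> T) (A B : set T) (g : T -> T) : Prop :=
  set_bij A B g /\ forall x : T, A x -> g (f x) = f (g x).

Definition automorphism (T : Type) (f : T -> T) (h : T -> T) : Prop :=
  isomorphism f setT setT h.

Definition ultrahomogeneous (T : Type) (f : T -> T) : Prop :=
  forall (A B : set T) (g : T -> T),
    finitely_generated f A -> finitely_generated f B -> isomorphism f A B g ->
    exists h : T -> T, automorphism f h /\ forall x : T, A x -> h x = g x.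

Lemma finitely_generatedP (T : Type) (eps : T) (f : T -> T) (A : set T) :
  is_tree eps f ->
  finitely_generated f A <-> finite_set A /\ substructure f A.
Proof.
move=> tf; split=> [[S finS ->]|[finA clA]]; last first.
  by exists A => //; rewrite smallest_id.
split; last by move=> x Ax B BP; apply: (BP.1); exact: Ax.
pose branch s := [set iter n f s | n in [set: nat]].
have fin_branch s : finite_set (branch s).
  have [k fk] := tree_reach tf s.
  apply: (@sub_finite_set _ _ [set iter n f s | n in `I_k.+1]).
    move=> _ [n _ <-]; have [nk|kn] := leqP n k; first by exists n.
    exists k => /=; first by rewrite ltnSn.
    rewrite -(subnK (ltnW kn)) iterD fk.
    by elim: (n - k)%N => //= i <-; rewrite tree_root.
  exact/finite_image/finite_II.
apply: (@sub_finite_set _ _ (\bigcup_(s in S) branch s)).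
  apply: smallest_sub => [x [s Ss [n _ <-]]|s Ss]; exists s => //.
    by exists n.+1.
  by exists 0%N.
exact: bigcup_finite.
Qed.

(* Main.v *)
Require Import Defs.
From mathcomp Require Import all_boot.
From mathcomp Require Import boolp classical_sets functions cardinality.

(** An isomorphism [g : A -> B] of nonempty substructures fixes the root and
    maps each successor of [x] that lies in [A] to a successor of [g x].

    If [(T, f)] is ultrahomogeneous and [a], [b] have the same height, then the
    branches of [a] and [b] down to the root are isomorphic substructures, by
    the map that sends the [i]-th predecessor of [a] to the [i]-th predecessor
    of [b] ([branch_iso]).  An automorphism that extends this map sends [a] to
    [b], hence the successors of [a] bijectively to those of [b]
    ([automorphism_successors]).

    Conversely, let [g : A -> B] be an isomorphism of finite substructures.
    Since [A] is finite, a bijection between the successors of two elements of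
    equal height can be corrected, by finitely many transpositions, so as to
    agree with [g] at the successors that lie in [A] ([bij_extension]).  Such
    local bijections are glued along the tree, by recursion on the height: the
    image of [x] is found by applying, to [x], the bijection from the
    successors of [f x] to the successors of the image already given to [f x].
    Since the local bijections are onto, so is the glued map, which is thus an
    automorphism ([glue_automorphism]); it agrees with [g] on [A] by induction
    on the height ([isomorphism_extends]). *)

Local Open Scope classical_set_scope.
Local Open Scope card_scope.

(** * Extending finite injections to bijections *)

Definition swap {U : Type} (u v z : U) : U :=
  if `[< z = u >] then v else if `[< z = v >] then u else z.

Lemma swapl {U : Type} (u v : U) : swap u v u = v.
Proof. by rewrite /swap; case: asboolP. Qed.

Lemma swapN {U : Type} (u v z : U) : z <> u -> z <> v -> swap u v z = z.
Proof. by rewrite /swap; case: asboolP => // _ _; case: asboolP. Qed.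

Lemma swapK {U : Type} (u v : U) : involutive (swap u v).
Proof.
move=> z; rewrite {2}/swap; case: asboolP => [->|zu].
  by rewrite /swap; case: asboolP => // _; case: asboolP.
by case: asboolP => [->|zv]; [rewrite swapl | rewrite swapN].
Qed.

Lemma set_bij_swap {U : Type} (Y : set U) (u v : U) :
  Y u -> Y v -> set_bij Y Y (swap u v).
Proof.
move=> Yu Yv; have swapY z : Y z -> Y (swap u v z).
  by move=> Yz; rewrite /swap; case: asboolP => // _; case: asboolP.
split=> //; first by move=> x y _ _; apply: (can_inj (swapK u v)).
by move=> y Yy; exists (swap u v y); [exact: swapY | exact: swapK].
Qed.

(** Composing with the transposition of the current and the prescribed value
    at one point does not disturb the points already treated: by injectivity,
    both values differ from theirs. *)
Lemma bij_extension {T U : Type} (X A : set T) (Y : set U) (g : T -> U) :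
  finite_set A -> A `<=` X -> set_fun A Y g -> set_inj A g -> X #= Y ->
  exists2 psi : T -> U, set_bij X Y psi & forall x, A x -> psi x = g x.
Proof.
move=> finA AX gY gI XY.
have [phi phi_bij] : exists phi : T -> U, set_bij X Y phi.
  elim/Ppointed: U => U in Y g gY gI XY *; last exact/card_set_bijP.
  by exists g; move: XY; rewrite !emptyE => ->; exact: set_bij00.
elim/Pchoice: T => T in X A g finA AX gY gI XY phi phi_bij *.
have [s sA] := (finite_seqP A).1 finA.
suff [psi psi_bij psiE] : exists2 psi : T -> U, set_bij X Y psi &
    forall x, x \in s -> psi x = g x.
  by exists psi => // x; rewrite sA; exact: psiE.
have {sA} : {subset s <= A} by move=> x xs; rewrite inE sA.
elim: s => [|x s IHs] sA; first by exists phi.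
have [|psi psi_bij psiE] := IHs.
  by move=> y ys; apply: sA; rewrite inE ys orbT.
have xA : x \in A by apply: sA; rewrite mem_head.
have [psiY psiI _] := psi_bij.
have Ax : A x by rewrite -in_setE.
exists (swap (psi x) (g x) \o psi).
  by apply: set_bij_comp psi_bij _; apply: set_bij_swap;
    [exact/psiY/AX | exact: gY].
move=> y; have [->|/eqP yx] := eqVneq y x; first by rewrite /= swapl.
rewrite inE => /orP[/eqP//|ys] /=.
have yA : y \in A by apply: sA; rewrite inE ys orbT.
have psi_y := psiE y ys.
rewrite swapN // => [psi_yx|psi_yg]; apply: yx; last first.
  by apply: gI; rewrite // -psi_y.
by apply: psiI => //; rewrite inE; apply: AX; rewrite -in_setE.
Qed.

(** * Heights *)

Section Tree.
Context {T : Type} {eps : T} {f : T -> T} (tree_T : is_tree eps f).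

Lemma fixpoint_root (a : T) : f a = a -> a = eps.
Proof. exact: (tree_acyclic tree_T (m := 1)). Qed.

Lemma iter_root (n : nat) : iter n f eps = eps.
Proof. by elim: n => //= n ->; exact: tree_root. Qed.

Lemma iter_ge_height (a : T) (m n : nat) :
  has_height eps f a n -> (n <= m)%N -> iter m f a = eps.
Proof. by move=> [an _] nm; rewrite -(subnK nm) iterD an iter_root. Qed.

Lemma has_height_exists (a : T) : exists n, has_height eps f a n.
Proof.
have an : exists n, `[< iter n f a = eps >].
  by have [n an] := tree_reach tree_T a; exists n; apply/asboolP.
by case: (ex_minnP an) => n /asboolP fa min; exists n; split=> // m /asboolP/min.
Qed.

Lemma has_height_uniq (a : T) (m n : nat) :
  has_height eps f a m -> has_height eps f a n -> m = n.
Proof. by move=> [am mP] [an nP]; apply/eqP; rewrite eqn_leq mP// nP. Qed.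

Lemma has_height_root : has_height eps f eps 0.
Proof. by []. Qed.

Lemma has_heightS (a : T) (n : nat) :
  a <> eps -> has_height eps f (f a) n -> has_height eps f a n.+1.
Proof.
move=> a0 [an nP]; split=> [|[//|m]]; rewrite iterSr//.
exact: nP.
Qed.

Lemma tree_induction (P : T -> Prop) :
  P eps -> (forall x, x <> eps -> P (f x) -> P x) -> forall x, P x.
Proof.
move=> P0 PS x; have [n] := tree_reach tree_T x.
elim: n x => [x /= ->//|n IHn x]; rewrite iterSr => /IHn Pfx.
by have [->//|x0] := pselect (x = eps); exact: PS.
Qed.

(** The recursion unfolds along the path from [x] to the root; the height of
    [x] serves as the fuel of a structural recursion on [nat]. *)
Lemma tree_recursion {U : Type} (u0 : U) (step : T -> U -> U) :
  exists2 h : T -> U, h eps = u0 & forall x, x <> eps -> h x = step x (h (f x)).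
Proof.
have [ht htP] := choice has_height_exists.
pose F := fix F n x := if n is m.+1 then step x (F m (f x)) else u0.
exists (fun x => F (ht x) x) => [|x x0].
  by rewrite (has_height_uniq _ _ _ (htP eps) has_height_root).
by rewrite (has_height_uniq _ _ _ (htP x) (has_heightS _ _ x0 (htP (f x)))).
Qed.

(** * Branches and automorphisms *)

Definition branch (a : T) : set T := [set iter i f a | i in [set: nat]].

Lemma branch_finitely_generated (a : T) : finitely_generated f (branch a).
Proof.
exists [set a]; first exact: finite_set1.
rewrite eqEsubset; split=> [_ [i _ <-] A [clA aA]|]; last first.
  apply: smallest_sub => [_ [i _ <-]|_ ->]; last by exists 0%N.
  by exists i.+1.
by elim: i => [|i Ai] /=; [exact: aA | exact: clA].
Qed.

Lemma branch_eq (a b : T) (n i j : nat) :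
  has_height eps f a n -> has_height eps f b n ->
  iter i f a = iter j f a -> iter i f b = iter j f b.
Proof.
move=> an bn; wlog ij : i j / (i <= j)%N => [wlg|].
  by case/orP: (leq_total i j) => ij aij; [|symmetry]; apply: wlg.
have [->//|ij'] := eqVneq i j.
rewrite -(subnK ij) iterD => aij.
(* A repetition on the branch of [a] occurs only at the root, so [i] and [j]
   are at least the common height. *)
have ai0 : iter i f a = eps.
  apply: (tree_acyclic tree_T (m := j - i)) => //.
  by rewrite subn_gt0 ltn_neqAle ij'.
have ni : (n <= i)%N by apply: an.2.
by rewrite iterD (iter_ge_height _ _ _ bn ni) iter_root.
Qed.

Lemma branch_iso (a b : T) (n : nat) :
  has_height eps f a n -> has_height eps f b n ->
  exists2 g : T -> T, isomorphism f (branch a) (branch b) g & g a = b.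
Proof.
move=> an bn.
have [x|g gP] := @choice T T (fun x y => forall i, iter i f a = x -> iter i f b = y).
  have [[j <-]|nx] := pselect (exists j, iter j f a = x).
    by exists (iter j f b) => i; exact: branch_eq an bn.
  by exists eps => i ix; case: nx; exists i.
have gE i : g (iter i f a) = iter i f b by rewrite -(gP _ i).
exists g; last exact: (gE 0%N).
split=> [|_ [i _ <-]]; last by rewrite gE; exact: (gE i.+1).
split=> [_ [i _ <-]|x y|_ [i _ <-]].
- by exists i => //; rewrite gE.
- rewrite !inE => -[i _ <-] [j _ <-]; rewrite !gE.
  exact: branch_eq bn an.
- by exists (iter i f a); [exists i | exact: gE].
Qed.

Lemma automorphism_inj (h : T -> T) : automorphism f h -> injective h.
Proof. by move=> [[_ hI _] _] x y; apply: hI; rewrite inE. Qed.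

Lemma automorphism_root (h : T -> T) : automorphism f h -> h eps = eps.
Proof.
by move=> [_ hf]; apply: fixpoint_root; rewrite -hf// (tree_root tree_T).
Qed.

Lemma automorphism_height (h : T -> T) (a : T) (n : nat) :
  automorphism f h -> has_height eps f a n -> has_height eps f (h a) n.
Proof.
move=> h_aut; have [_ hf] := h_aut.
have iter_h i : iter i f (h a) = h (iter i f a).
  by elim: i => //= i ->; rewrite hf.
move=> [an nP]; split=> [|m]; rewrite iter_h.
  by rewrite an automorphism_root.
by rewrite -{1}(automorphism_root _ h_aut) => /(automorphism_inj _ h_aut)/nP.
Qed.

Lemma automorphism_successors (h : T -> T) (a : T) :
  automorphism f h -> successors eps f a #= successors eps f (h a).
Proof.
move=> h_aut; have [[_ _ hS] hf] := h_aut.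
have h_inj := automorphism_inj _ h_aut; have h0 := automorphism_root _ h_aut.
suff <- : h @` successors eps f a = successors eps f (h a).
  by apply/card_esym/inj_card_eq => x y _ _; exact: h_inj.
rewrite eqEsubset; split=> [_ [x [x0 <-] <-]|y [y0 fy]].
  by split; [rewrite -h0 => /h_inj | rewrite -hf].
have [x _ hx] := hS y I; exists x => //; split=> [x0|].
  by apply: y0; rewrite -hx x0.
by apply: h_inj; rewrite hf// hx.
Qed.

(** * Gluing bijections between sets of successors *)

(** The recursion makes [h] preserve heights, which is what gives access to
    the hypothesis on [phi] at each step.  Injectivity and surjectivity then
    follow by climbing from the root. *)
Lemma glue_automorphism (phi : T -> T -> T -> T) (h : T -> T) :
  (forall n a b, has_height eps f a n -> has_height eps f b n ->
     set_bij (successors eps f a) (successors eps f b) (phi a b)) ->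
  h eps = eps -> (forall x, x <> eps -> h x = phi (f x) (h (f x)) x) ->
  automorphism f h.
Proof.
move=> phi_bij h0 hE.
have succ_h x n : x <> eps ->
    has_height eps f (f x) n -> has_height eps f (h (f x)) n ->
    h x <> eps /\ f (h x) = h (f x).
  by move=> x0 xn hxn; rewrite hE//; have [phiS _ _] := phi_bij _ _ _ xn hxn;
    exact: phiS.
have h_height x : exists2 n, has_height eps f x n & has_height eps f (h x) n.
  elim/tree_induction: x => [|x x0 [n xn hxn]].
    by exists 0%N; rewrite ?h0; exact: has_height_root.
  have [hx0 fhx] := succ_h _ _ x0 xn hxn.
  by exists n.+1; apply: has_heightS; rewrite ?fhx.
have h_neq0 x : x <> eps -> h x <> eps.
  by move=> x0; have [n xn hxn] := h_height (f x); have [] := succ_h _ _ x0 xn hxn.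
have hf x : h (f x) = f (h x).
  have [->|x0] := pselect (x = eps); first by rewrite h0 (tree_root tree_T).
  by have [n xn hxn] := h_height (f x); have [] := succ_h _ _ x0 xn hxn.
have h_bij x := let: ex_intro2 n xn hxn := h_height x in phi_bij _ _ _ xn hxn.
split=> //; split=> // [x y _ _|y _].
- elim/tree_induction: x y => [|x x0 IHx] y hxy.
    by have [->//|/h_neq0] := pselect (y = eps); rewrite -hxy h0.
  have y0 : y <> eps by move=> y0; apply: (h_neq0 _ x0); rewrite hxy y0.
  have fxy : f x = f y by apply: IHx; rewrite !hf hxy.
  have [_ phiI _] := h_bij (f x).
  by apply: phiI; [rewrite inE | rewrite inE | rewrite -hE// hxy hE// fxy].
- elim/tree_induction: y => [|y y0 [z _ hz]]; first by exists eps.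
  have [_ _ phiS] := h_bij z.
  have [x [x0 fx] <-] : (phi z (h z) @` successors eps f z) y by exact: phiS.
  by exists x => //; rewrite hE// fx.
Qed.

(** Because [A] is closed under [f], the induction that compares [h] with [g]
    stays in [A]: once [h (f x) = g (f x)], the bijection that [h] uses at
    [f x] is one that was chosen to follow [g]. *)
Lemma isomorphism_extends (A B : set T) (g : T -> T) :
  (forall n a b, has_height eps f a n -> has_height eps f b n ->
     successors eps f a #= successors eps f b) ->
  finite_set A -> substructure f A -> isomorphism f A B g ->
  exists h : T -> T, automorphism f h /\ forall x, A x -> h x = g x.
Proof.
move=> same_succ finA clA [[_ gI _] gf].
have A0 x : A x -> A eps.
  by elim/tree_induction: x => // x _ IHx Ax; exact/IHx/clA.
have g0 : A eps -> g eps = eps.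
  by move=> Ae; apply: fixpoint_root; rewrite -gf// (tree_root tree_T).
have local_bij (ab : T * T) : exists phi : T -> T,
    (exists2 n, has_height eps f ab.1 n & has_height eps f ab.2 n) ->
    set_bij (successors eps f ab.1) (successors eps f ab.2) phi /\
    (g ab.1 = ab.2 ->
     forall x, A x -> successors eps f ab.1 x -> phi x = g x).
  case: ab => a b /=.
  have [[n an bn]|] := pselect (exists2 n, has_height eps f a n &
    has_height eps f b n); last by exists id.
  (* Emptying the set of prescribed points when [g a <> b] makes one extension
     argument cover all pairs. *)
  pose S := [set x | [/\ A x, g a = b & successors eps f a x]].
  have [||||//|phi phi_bij phiE] := @bij_extension T T (successors eps f a) S
      (successors eps f b) g.
  - by apply: sub_finite_set finA => x [].
  - by move=> x [].
  - move=> x [Ax gab [x0 fx]]; split; last by rewrite -gf// fx.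
    move=> gx0; apply: x0; apply: gI; rewrite ?inE//; first exact: A0 Ax.
    by rewrite gx0 g0//; exact: A0 Ax.
  - by move=> x y; rewrite !inE => -[Ax _ _] [Ay _ _]; apply: gI; rewrite inE.
  - exact: same_succ an bn.
  - by exists phi => _; split=> // gab x Ax xa; exact: phiE.
have [phi phiP] := choice local_bij.
have [h h0 hE] := tree_recursion eps (fun x y => phi (f x, y) x).
have h_aut : automorphism f h.
  apply: (glue_automorphism (fun a b => phi (a, b))) => // n a b an bn.
  by have [] := phiP (a, b); first by exists n.
exists h; split=> // x.
elim/tree_induction: x => [Ae|x x0 IHx Ax]; first by rewrite h0 g0.
have [n fxn] := has_height_exists (f x).
have hfx : h (f x) = g (f x) by apply: IHx; exact: clA.
have [|_ phiE] := phiP (f x, h (f x)).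
  by exists n => //; exact: automorphism_height.
by rewrite hE//; exact: phiE.
Qed.

End Tree.

Theorem theorem7p10 (T : Type) (eps : T) (f : T -> T)
    (tree_T : is_tree eps f) (countable_T : countable [set: T]) :
  ultrahomogeneous f <->
  (forall (n : nat) (a b : T),
     has_height eps f a n -> has_height eps f b n ->
     successors eps f a #= successors eps f b).
Proof.
split=> [homog n a b an bn|same_succ A B g fgA _ iso_g].
  have [g iso_g gab] := branch_iso tree_T _ _ _ an bn.
  have [h [h_aut hE]] := homog _ _ _ (branch_finitely_generated _)
    (branch_finitely_generated _) iso_g.
  have <- : h a = b by rewrite hE//; exists 0%N.
  exact: automorphism_successors.
have [finA clA] := (finitely_generatedP _ tree_T).1 fgA.
exact: (isomorphism_extends tree_T A B).
Qed.
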